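(* Every complex structure $J$ on $\mathfrak{su}(2)\oplus\mathfrak{su}(2)$ is equivalent, under some member of $SO(3)\times SO(3)$, to $$J(\xi,\eta)=\begin{pmatrix} 0&1&0&0&0&0\\ -1&0&0&0&0&0\\ 0&0&\xi&0&0&\eta\\ 0&0&0&0&1&0\\ 0&0&0&-1&0&0\\ 0&0&-\frac{1+\xi^2}{\eta}&0&0&-\xi \end{pmatrix}$$ for some $\xi,\eta\in\mathbb{R}$ with $\eta\neq0$. Moreover, for $\xi,\xi',\eta,\eta'\in\mathbb{R}$ with $\eta,\eta'\ne0$: $J(\xi,\eta)$ and $J(\xi',\eta')$ are equivalent under some member of $SO(3)\times SO(3)$ if and only if $\xi'=\xi$ and $\eta'=\eta$; and $J(\xi,\eta)$ and $J(\xi',\eta')$ are equivalent under some member of $\tau(SO(3)\times SO(3))$ if and only if $\xi'=-\xi$ and $\eta'=-\frac{1+\xi^2}{\eta}$.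
   Context: $\mathfrak{su}(2)\oplus\mathfrak{su}(2)$ has basis $(J^{(1)}_1,J^{(1)}_2,J^{(1)}_3,J^{(2)}_1,J^{(2)}_2,J^{(2)}_3)$, where for each $k=1,2$: $[J^{(k)}_1,J^{(k)}_2]=J^{(k)}_3$, $[J^{(k)}_2,J^{(k)}_3]=J^{(k)}_1$, $[J^{(k)}_3,J^{(k)}_1]=J^{(k)}_2$, and brackets between different factors vanish. Linear maps are identified with their matrices in this basis (columns are images of basis vectors). $SO(3)\times SO(3)$ denotes the group of block-diagonal matrices $\mathrm{diag}(\Phi_1,\Phi_2)$ with $\Phi_1,\Phi_2\in SO(3)$, and $\tau=\begin{pmatrix} 0 & I \\ I & 0 \end{pmatrix}$ ($3\times3$ blocks) is the switch of the two factors; $\tau(SO(3)\times SO(3))=\{\tau\Phi:\Phi\in SO(3)\times SO(3)\}$. A complex structure on a real Lie algebra $\mathfrak{g}$ is a linear map $J$ with $J^2=-1$ and $[JX,JY]-[X,Y]-J[JX,Y]-J[X,JY]=0$ for all $X,Y\in\mathfrak{g}$. $J$ and $J'$ are equivalent under some member of a set $S$ of automorphisms if $J'=\Psi J\Psi^{-1}$ for some $\Psi\in S$. *)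

(* Defs.v *)
From HB Require Import structures.
From mathcomp Require Import all_boot all_order all_algebra.
From mathcomp Require Import classical_sets reals ring.

Set Implicit Arguments.
Unset Strict Implicit.
Unset Printing Implicit Defensive.

Import GRing.Theory.
Local Open Scope ring_scope.
Local Open Scope classical_set_scope.

(* A linear map is identified with its matrix A in the chosen basis, the columns
   of A being the images of the basis vectors: elements of the Lie algebra are
   column vectors and the map is X |-> A *m X. *)

Definition is_lie_bracket (R : realType) (n : nat)
    (br : 'cV[R]_n -> 'cV[R]_n -> 'cV[R]_n) : Prop :=
  [/\ forall (a : R) (X X' Y : 'cV[R]_n),
        br (a *: X + X') Y = a *: br X Y + br X' Y,
      forall (a : R) (X Y Y' : 'cV[R]_n),
        br X (a *: Y + Y') = a *: br X Y + br X Y',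
      forall X : 'cV[R]_n, br X X = 0 &
      forall X Y Z : 'cV[R]_n,
        br X (br Y Z) + br Y (br Z X) + br Z (br X Y) = 0].

Definition is_complex_structure (R : realType) (n : nat)
    (br : 'cV[R]_n -> 'cV[R]_n -> 'cV[R]_n) (J : 'M[R]_n) : Prop :=
  J *m J = - 1%:M /\
  forall X Y : 'cV[R]_n,
    br (J *m X) (J *m Y) - br X Y - J *m br (J *m X) Y - J *m br X (J *m Y) = 0.

Definition equivalent_under (R : realType) (n : nat) (S : set 'M[R]_n)
    (J J' : 'M[R]_n) : Prop :=
  exists2 Psi : 'M[R]_n, S Psi & J' = Psi *m J *m invmx Psi.

(* Alternating bilinear extension of [J_1,J_2] = J_3, [J_2,J_3] = J_1, [J_3,J_1] = J_2:
   indices i + 1, i + 2 are taken in the cyclic group 'I_3. *)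
Definition su2_bracket (R : realType) (X Y : 'cV[R]_3) : 'cV[R]_3 :=
  \col_(i < 3) (X (i + 1) 0 * Y (i + 2) 0 - X (i + 2) 0 * Y (i + 1) 0).

(* Coordinates are with respect to the basis (J^(1)_1, J^(1)_2, J^(1)_3,
   J^(2)_1, J^(2)_2, J^(2)_3). *)
Definition su2su2_bracket (R : realType) (X Y : 'cV[R]_(3 + 3)) :
    'cV[R]_(3 + 3) :=
  col_mx (su2_bracket (usubmx X) (usubmx Y))
         (su2_bracket (dsubmx X) (dsubmx Y)).

Definition SO3 (R : realType) : set 'M[R]_3 :=
  [set Phi | Phi *m Phi^T = 1%:M /\ \det Phi = 1].

Definition SO3xSO3 (R : realType) : set 'M[R]_(3 + 3) :=
  [set block_mx Phi.1 0 0 Phi.2 | Phi in @SO3 R `*` @SO3 R].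

Definition switch (R : realType) : 'M[R]_(3 + 3) := block_mx 0 1%:M 1%:M 0.

Definition switch_SO3xSO3 (R : realType) : set 'M[R]_(3 + 3) :=
  [set switch R *m Phi | Phi in @SO3xSO3 R].

Definition Jcan_rows (R : realType) (xi eta : R) : seq (seq R) :=
  [:: [:: 0;   1; 0;                        0;   0; 0    ];
      [:: - 1; 0; 0;                        0;   0; 0    ];
      [:: 0;   0; xi;                       0;   0; eta  ];
      [:: 0;   0; 0;                        0;   1; 0    ];
      [:: 0;   0; 0;                        - 1; 0; 0    ];
      [:: 0;   0; - ((1 + xi ^+ 2) / eta);  0;   0; - xi ]].

Definition Jcan (R : realType) (xi eta : R) : 'M[R]_(3 + 3) :=
  \matrix_(i < 3 + 3, j < 3 + 3) nth 0 (nth [::] (Jcan_rows xi eta) i) j.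

Lemma su2_bracket_basis (R : realType) (i : 'I_3) :
  su2_bracket (delta_mx i 0 : 'cV[R]_3) (delta_mx (i + 1) 0) =
  delta_mx (i + 2) 0.
Proof.
apply/matrixP => k j; rewrite ord1 !mxE.
by case: i => [[|[|[|]]] //= ?]; case: k => [[|[|[|]]] //= ?];
   rewrite ?(mul0r, mulr0, mul1r, mulr1, subr0, sub0r, oppr0).
Qed.

Lemma su2_bracket_lie (R : realType) : is_lie_bracket (@su2_bracket R).
Proof.
split=> [a X X' Y|a X Y Y'|X|X Y Z]; apply/matrixP => i j;
  rewrite ord1 !mxE; [ring|ring|ring|].
have e3 (k : 'I_3) : k + 1 + 1 = k + 2 /\ k + 2 + 2 = k + 1 :> 'I_3.
  by split; apply/val_inj; case: k => [[|[|[|]]] ?].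
have e0 (k : 'I_3) : k + 1 + 2 = k /\ k + 2 + 1 = k :> 'I_3.
  by split; apply/val_inj; case: k => [[|[|[|]]] ?].
rewrite !(e3 i).1 !(e3 i).2 !(e0 i).1 !(e0 i).2; ring.
Qed.

Lemma su2su2_bracket_lie (R : realType) : is_lie_bracket (@su2su2_bracket R).
Proof.
have [linl linr alt jac] := su2_bracket_lie R.
split=> [a X X' Y|a X Y Y'|X|X Y Z]; rewrite /su2su2_bracket.
- by rewrite !linearP /= !linl scale_col_mx add_col_mx.
- by rewrite !linearP /= !linr scale_col_mx add_col_mx.
- by rewrite !alt col_mx0.
- by rewrite !col_mxKu !col_mxKd !add_col_mx !jac col_mx0.
Qed.

(* Main.v *)
(* Write [J] in 3x3 blocks [A, B; C, D]. On each factor the vanishing of the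
   Nijenhuis tensor turns, via the cross product identities, into
   [cof A = 1 + tr A * A - A A^T], which forces [A = t u u^T + (u x -)] for a unit
   vector [u]; likewise for [D]. Rotating both axes to [- e_3], the relation
   [C A + D C = 0] and the remaining part of the tensor leave only the (3, 3)
   entry of [C], and similarly for [B]; [J^2 = -1] then fixes the rest.
   The axis and the trace of [A] are recovered from [A], so an equivalence between
   two canonical forms fixes [e_3] in both factors and preserves [xi] and [eta].
   Finally the switch conjugates one canonical form into another. *)

Require Import Defs.
From mathcomp Require Import all_boot all_order all_algebra.
From mathcomp Require Import classical_sets reals ring lra.

Set Implicit Arguments.
Unset Strict Implicit.
Unset Printing Implicit Defensive.

Import Order.TTheory GRing.Theory Num.Theory.
Local Open Scope ring_scope.

(** * Coordinates and determinants in dimension three *)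

Lemma ord3_ind (P : 'I_3 -> Prop) : P 0 -> P 1 -> P 2 -> forall i, P i.
Proof.
move=> P0 P1 P2 [[|[|[|//]]] i3].
- by rewrite (_ : Ordinal i3 = 0) //; apply: val_inj.
- by rewrite (_ : Ordinal i3 = 1) //; apply: val_inj.
- by rewrite (_ : Ordinal i3 = 2) //; apply: val_inj.
Qed.

Lemma big_ord3 (V : nmodType) (F : 'I_3 -> V) : \sum_i F i = F 0 + F 1 + F 2.
Proof.
rewrite !big_ord_recl big_ord0 addr0 addrA.
by congr (F _ + F _ + F _); apply: val_inj.
Qed.

Lemma ord3D :
  ((((0 + 1)%R = 1%R :> 'I_3) * ((1 + 1)%R = 2%R :> 'I_3) *
    ((2 + 1)%R = 0%R :> 'I_3) * ((0 + 2)%R = 2%R :> 'I_3) *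
    ((1 + 2)%R = 0%R :> 'I_3) * ((2 + 2)%R = 1%R :> 'I_3)))%type.
Proof. by do !split; apply: val_inj. Qed.

Lemma det3 (R : comNzRingType) (A : 'M[R]_3) :
  \det A = A 0 0 * (A 1 1 * A 2 2 - A 1 2 * A 2 1)
         - A 0 1 * (A 1 0 * A 2 2 - A 1 2 * A 2 0)
         + A 0 2 * (A 1 0 * A 2 1 - A 1 1 * A 2 0).
Proof.
have lift3 : ((lift (0)%R (0%R : 'I_2) = 1%R :> 'I_3) * (lift (0)%R (1%R : 'I_2) = 2%R :> 'I_3) *
  (lift (1)%R (0%R : 'I_2) = 0%R :> 'I_3) * (lift (1)%R (1%R : 'I_2) = 2%R :> 'I_3) *
  (lift (2)%R (0%R : 'I_2) = 0%R :> 'I_3) * (lift (2)%R (1%R : 'I_2) = 1%R :> 'I_3))%type.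
  by do !split; apply: val_inj.
have det2 (B : 'M[R]_2) : \det B = B 0 0 * B 1 1 - B 0 1 * B 1 0.
  rewrite (expand_det_row _ 0) big_ord_recl big_ord1 /cofactor !det_mx11 !mxE /=.
  rewrite expr0 expr1 mulN1r mul1r mulrN.
  by congr (_ * B _ _ - B _ _ * B _ _); apply: val_inj.
rewrite (expand_det_row _ 0) big_ord3 /cofactor !det2 !mxE !lift3 /=.
by rewrite !expr0 !expr1 sqrrN; ring.
Qed.

Lemma su2_bracketDl (R : realType) (X X' Y : 'cV[R]_3) :
  su2_bracket (X + X') Y = su2_bracket X Y + su2_bracket X' Y.
Proof. by have [/(_ 1)+ _ _ _] := su2_bracket_lie R => /(_ X X' Y); rewrite !scale1r. Qed.


Lemma ord3_neq :
  (((0%R == 1%R :> 'I_3) = false) * ((0%R == 2%R :> 'I_3) = false) *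
   ((1%R == 0%R :> 'I_3) = false) * ((1%R == 2%R :> 'I_3) = false) *
   ((2%R == 0%R :> 'I_3) = false) * ((2%R == 1%R :> 'I_3) = false))%type.
Proof. by []. Qed.

(** * Algebra of the cofactor relation *)

(* The hypotheses are the entries of [cof A = 1 + tr A * A - A A^T], where
   [A = S + W] with [S] symmetric with entries [a, ..., f] and [W] the cross
   product by [w = (x, y, z)]. *)
Lemma cofactor_relation_axis (R : realType) (a b c d e f x y z : R) :
  let t := a + b + c in
  b * c - (f - x) * (f + x) = 1 + t * a - (a ^+ 2 + (d - z) ^+ 2 + (e + y) ^+ 2) ->
  a * c - (e + y) * (e - y) = 1 + t * b - ((d + z) ^+ 2 + b ^+ 2 + (f - x) ^+ 2) ->
  a * b - (d - z) * (d + z) = 1 + t * c - ((e - y) ^+ 2 + (f + x) ^+ 2 + c ^+ 2) ->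
  (f - x) * (e - y) - (d + z) * c =
    t * (d - z) - (a * (d + z) + (d - z) * b + (e + y) * (f - x)) ->
  (f + x) * (e + y) - (d - z) * c =
    t * (d + z) - (a * (d + z) + (d - z) * b + (e + y) * (f - x)) ->
  (d + z) * (f + x) - b * (e - y) =
    t * (e + y) - (a * (e - y) + (d - z) * (f + x) + (e + y) * c) ->
  (d - z) * (f - x) - b * (e + y) =
    t * (e - y) - (a * (e - y) + (d - z) * (f + x) + (e + y) * c) ->
  (d - z) * (e - y) - a * (f + x) =
    t * (f - x) - ((d + z) * (e - y) + b * (f + x) + (f - x) * c) ->
  (d + z) * (e + y) - a * (f - x) =
    t * (f + x) - ((d + z) * (e - y) + b * (f + x) + (f - x) * c) ->
  x ^+ 2 + y ^+ 2 + z ^+ 2 = 1 /\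
  [/\ a = t * x ^+ 2, b = t * y ^+ 2 & c = t * z ^+ 2] /\
  [/\ d = t * (x * y), e = t * (x * z) & f = t * (y * z)].
Proof.
move=> t; rewrite /t => E00 E11 E22 E01 E10 E02 E20 E12 E21.
(* [X], [Y], [Z] express [S w = (tr S) w]. *)
have X : (b + c) * x = d * y + e * z by clear - E12 E21; lra.
have Y : (a + c) * y = d * x + f * z by clear - E02 E20; lra.
have Z : (a + b) * z = e * x + f * y by clear - E10 E01; lra.
(* [w2] is the squared norm of [w], and [s2] the second elementary symmetric function of the
   eigenvalues of [S]. The trace of the relation, with [tr (S^2) = t^2 - 2 s2], links the two. *)
set w2 := x ^+ 2 + y ^+ 2 + z ^+ 2.
pose s2 := a * b + a * c + b * c - d ^+ 2 - e ^+ 2 - f ^+ 2.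
have s2E : 3 * (w2 + s2) + 2 * (a ^+ 2 + b ^+ 2 + c ^+ 2)
    + 4 * (d ^+ 2 + e ^+ 2 + f ^+ 2) = 3 + 2 * (a + b + c) ^+ 2.
  rewrite /w2 /s2; clear - E00 E11 E22; lra.
have s2E' : s2 = 3 * (w2 - 1) by move: s2E; rewrite /s2; clear; lra.
(* By Cayley-Hamilton the relation reads [2 S^2 + 2 W S - 2 t S + k = 0]; the
   [Zj] below are entries of its left-hand side, and applying it to [w] leaves
   [k w = 0]. *)
pose k := w2 + s2 - 1.
pose h0 := d * y + e * z - (b + c) * x.
pose h1 := d * x + f * z - (a + c) * y.
pose h2 := e * x + f * y - (a + b) * z.
have h0E : h0 = 0 by rewrite /h0 -X subrr.
have h1E : h1 = 0 by rewrite /h1 -Y subrr.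
have h2E : h2 = 0 by rewrite /h2 -Z subrr.
have kx : k * x = 0.
  pose Z0 := 2 * (a * a + d * d + e * e) + 2 * (- z * d + y * e) - 2 * (a + b + c) * a + k.
  have Z0E : Z0 = 0 by rewrite /Z0 /k /w2 /s2; clear - E00; lra.
  pose Z1 := 2 * (a * d + d * b + e * f) + 2 * (- z * b + y * f) - 2 * (a + b + c) * d.
  have Z1E : Z1 = 0 by rewrite /Z1; clear - E10; lra.
  pose Z2 := 2 * (a * e + d * f + e * c) + 2 * (- z * f + y * c) - 2 * (a + b + c) * e.
  have Z2E : Z2 = 0 by rewrite /Z2; clear - E20; lra.
  (* Since [W w = 0], the left-hand side applied to [w] is [k w + 2 (S + W) (S w - t w)], and [h0],
     [h1], [h2] are the coordinates of [S w - t w]. *)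
  have -> : k * x = Z0 * x + Z1 * y + Z2 * z
      - 2 * (a * h0 + d * h1 + e * h2) - 2 * (- z * h1 + y * h2).
    by rewrite /Z0 /Z1 /Z2 /h0 /h1 /h2; ring.
  by rewrite Z0E Z1E Z2E h0E h1E h2E; ring.
have ky : k * y = 0.
  pose Z0 := 2 * (d * a + b * d + f * e) + 2 * (z * a + - x * e) - 2 * (a + b + c) * d.
  have Z0E : Z0 = 0 by rewrite /Z0; clear - E01; lra.
  pose Z1 := 2 * (d * d + b * b + f * f) + 2 * (z * d + - x * f) - 2 * (a + b + c) * b + k.
  have Z1E : Z1 = 0 by rewrite /Z1 /k /w2 /s2; clear - E11; lra.
  pose Z2 := 2 * (d * e + b * f + f * c) + 2 * (z * e + - x * c) - 2 * (a + b + c) * f.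
  have Z2E : Z2 = 0 by rewrite /Z2; clear - E21; lra.
  have -> : k * y = Z0 * x + Z1 * y + Z2 * z
      - 2 * (d * h0 + b * h1 + f * h2) - 2 * (z * h0 + - x * h2).
    by rewrite /Z0 /Z1 /Z2 /h0 /h1 /h2; ring.
  by rewrite Z0E Z1E Z2E h0E h1E h2E; ring.
have kz : k * z = 0.
  pose Z0 := 2 * (e * a + f * d + c * e) + 2 * (- y * a + x * d) - 2 * (a + b + c) * e.
  have Z0E : Z0 = 0 by rewrite /Z0; clear - E02; lra.
  pose Z1 := 2 * (e * d + f * b + c * f) + 2 * (- y * d + x * b) - 2 * (a + b + c) * f.
  have Z1E : Z1 = 0 by rewrite /Z1; clear - E12; lra.
  pose Z2 := 2 * (e * e + f * f + c * c) + 2 * (- y * e + x * f) - 2 * (a + b + c) * c + k.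
  have Z2E : Z2 = 0 by rewrite /Z2 /k /w2 /s2; clear - E22; lra.
  have -> : k * z = Z0 * x + Z1 * y + Z2 * z
      - 2 * (e * h0 + f * h1 + c * h2) - 2 * (- y * h0 + x * h1).
    by rewrite /Z0 /Z1 /Z2 /h0 /h1 /h2; ring.
  by rewrite Z0E Z1E Z2E h0E h1E h2E; ring.
have w1 : w2 = 1.
  have: k * w2 = 0.
    have -> : k * w2 = k * x * x + k * y * y + k * z * z by rewrite /w2; ring.
    by rewrite kx ky kz; ring.
  (* If [k = 0], then [s2 = 3 (w2 - 1)] forces [w2 = 1]; the case [w = 0] has to be refuted. *)
  move/eqP; rewrite mulf_eq0 => /orP[/eqP k0|/eqP w0]; first by rewrite /k s2E' in k0; lra.
  exfalso.
  have x0 : x = 0 by move: w0; rewrite /w2; nra.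
  have y0 : y = 0 by move: w0; rewrite /w2; nra.
  have z0 : z = 0 by move: w0; rewrite /w2; nra.
  rewrite w0 in s2E'.
  rewrite x0 y0 z0 in E00 E11 E22 E01 E10 E02 E20 E12 E21.
  have C00 : b * c - f ^+ 2 = -1 by move: s2E'; rewrite /s2; clear - E00; lra.
  have C11 : a * c - e ^+ 2 = -1 by move: s2E'; rewrite /s2; clear - E11; lra.
  have C22 : a * b - d ^+ 2 = -1 by move: s2E'; rewrite /s2; clear - E22; lra.
  have C01 : d * c - e * f = 0 by clear - E10 E01; lra.
  have C02 : d * f - b * e = 0 by clear - E02; lra.
  have C12 : a * f - d * e = 0 by clear - E12; lra.
  (* When [w = 0], [cof S = -1], so that [(det S)^2 = det (cof S) = -1]. *)
  have D : (a * (b * c - f ^+ 2) - d * (d * c - e * f) + e * (d * f - b * e)) ^+ 2 = -1.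
    transitivity ((b * c - f ^+ 2) * ((a * c - e ^+ 2) * (a * b - d ^+ 2) - (a * f - d * e) ^+ 2)
      - (d * c - e * f) * ((d * c - e * f) * (a * b - d ^+ 2) - (a * f - d * e) * (d * f - b * e))
      - (d * f - b * e) * ((d * f - b * e) * (a * c - e ^+ 2) - (d * c - e * f) * (a * f - d * e))).
      ring.
    rewrite C00 C11 C22 C01 C02 C12; ring.
  have := sqr_ge0 (a * (b * c - f ^+ 2) - d * (d * c - e * f) + e * (d * f - b * e)).
  by rewrite D; lra.
have s0 : s2 = 0 by rewrite s2E' w1 subrr mulr0.
(* The squared norm of [S - t w w^T] vanishes. *)
split=> //.
have SS : (a - t * x ^+ 2) ^+ 2 + (b - t * y ^+ 2) ^+ 2 + (c - t * z ^+ 2) ^+ 2 +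
  2 * ((d - t * (x * y)) ^+ 2 + (e - t * (x * z)) ^+ 2 + (f - t * (y * z)) ^+ 2) = 0.
  (* Expand with [|S|^2 = t^2 - 2 s2] and [w^T S w = t w2 + w^T h]. *)
  transitivity (t ^+ 2 * (w2 ^+ 2 - 2 * w2 + 1) - 2 * s2 - 2 * t * (x * h0 + y * h1 + z * h2)).
    by rewrite /w2 /s2 /h0 /h1 /h2 /t; ring.
  by rewrite w1 s0 h0E h1E h2E; ring.
have := (sqr_ge0 (a - t * x ^+ 2), sqr_ge0 (b - t * y ^+ 2), sqr_ge0 (c - t * z ^+ 2),
  sqr_ge0 (d - t * (x * y)), sqr_ge0 (e - t * (x * z)), sqr_ge0 (f - t * (y * z))).
move: SS; rewrite /t.
have sq0 (p q : R) : (p - q) ^+ 2 = 0 -> p = q by move/eqP; rewrite sqrf_eq0 subr_eq0 => /eqP.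
by move=> SS [[[[[? ?] ?] ?] ?] ?]; do !split; apply: sq0; lra.
Qed.

(** * Axis matrices and rotations *)

Definition cross_mx (R : realType) (u : 'cV[R]_3) : 'M[R]_3 :=
  \matrix_(i, j) su2_bracket u (delta_mx j 0) i 0.

(** For a unit vector [u]: multiplication by [t] on the axis and a quarter turn in the plane
    orthogonal to it. *)
Definition axis_mx (R : realType) (t : R) (u : 'cV[R]_3) : 'M[R]_3 :=
  t *: (u *m u^T) + cross_mx u.

Lemma mulmx_cV_inj (R : pzSemiRingType) (m n : nat) (A B : 'M[R]_(m, n)) :
  (forall X : 'cV_n, A *m X = B *m X) -> A = B.
Proof.
move=> AB; apply/matrixP => i j.
by have /matrixP/(_ i 0) := AB (delta_mx j 0); rewrite -!colE !mxE.
Qed.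

Lemma cross_mxE (R : realType) (u X : 'cV[R]_3) :
  cross_mx u *m X = su2_bracket u X.
Proof.
apply/matrixP => i j; rewrite ord1 {j}; elim/ord3_ind: i;
  by rewrite !(mxE, big_ord3) !ord3D !eqxx !ord3_neq /=; ring.
Qed.

(** Pairing with a vector [Z] turns this into multiplicativity of the determinant on the triple
    [X, Y, Z]. *)
Lemma mulmx_su2_bracket (R : realType) (A : 'M[R]_3) (X Y : 'cV[R]_3) :
  A^T *m su2_bracket (A *m X) (A *m Y) = \det A *: su2_bracket X Y.
Proof.
apply/matrixP => i j; rewrite ord1 {j} det3; elim/ord3_ind: i;
  by rewrite !(mxE, big_ord3) !ord3D /=; ring.
Qed.

Lemma SO3_su2_bracket (R : realType) (Phi : 'M[R]_3) (X Y : 'cV[R]_3) :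
  SO3 Phi -> su2_bracket (Phi *m X) (Phi *m Y) = Phi *m su2_bracket X Y.
Proof.
case=> PPt detP; have := mulmx_su2_bracket Phi X Y; rewrite detP scale1r => <-.
by rewrite mulmxA PPt mul1mx.
Qed.

Lemma SO3_axis_mx (R : realType) (Phi : 'M[R]_3) (t : R) (u : 'cV[R]_3) :
  SO3 Phi -> Phi *m axis_mx t u *m Phi^T = axis_mx t (Phi *m u).
Proof.
move=> SOP; rewrite /axis_mx mulmxDr mulmxDl -scalemxAr -scalemxAl trmx_mul !mulmxA.
congr (_ + _); apply: mulmx_cV_inj => X.
rewrite -!mulmxA !cross_mxE -SO3_su2_bracket // mulmxA.
by rewrite (proj1 SOP) mul1mx.
Qed.

(** The term in [u u^T] is symmetric, so the skew part of the matrix alone determines [u]. *)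
Lemma axis_mx_inj (R : realType) (t t' : R) (u u' : 'cV[R]_3) :
  axis_mx t u = axis_mx t' u' -> u = u'.
Proof.
move=> E; have E' i j : axis_mx t u i j = axis_mx t' u' i j by rewrite E.
have := (E' 0 1, E' 1 0, E' 0 2, E' 2 0, E' 1 2, E' 2 1).
rewrite !(mxE, big_ord1) !ord3D !eqxx !ord3_neq /= => Es.
by apply/matrixP => i j; rewrite ord1 {j}; elim/ord3_ind: i; move: Es => [[[[[]]]]]; lra.
Qed.

Lemma mxtrace_axis_mx (R : realType) (t : R) (u : 'cV[R]_3) :
  u^T *m u = 1%:M -> \tr (axis_mx t u) = t.
Proof.
move=> u1; rewrite mxtraceD mxtraceZ mxtrace_mulC u1 mxtrace1 mulr1 /mxtrace big_ord3.
by rewrite !mxE !ord3D !eqxx !ord3_neq /=; ring.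
Qed.

(* The half-turn about the bisector of [u] and [- e_3], unless [u = e_3]. *)
Lemma SO3_to_pole (R : realType) (u : 'cV[R]_3) :
  u^T *m u = 1%:M -> exists2 Phi, SO3 Phi & Phi *m u = - delta_mx 2 0.
Proof.
move=> u1; have n1 : u 0 0 ^+ 2 + u 1 0 ^+ 2 + u 2 0 ^+ 2 = 1.
  by have := congr1 (fun M : 'M_1 => M 0 0) u1; rewrite !(mxE, big_ord3) /= !expr2.
have [z1|z1] := eqVneq (u 2 0) 1.
  have x0 : u 0 0 = 0 by move: n1; rewrite z1; nra.
  have y0 : u 1 0 = 0 by move: n1; rewrite z1; nra.
  (* Here [u = e_3], which the half-turn about [e_1] reverses. *)
  exists (diag_mx (\row_i (if i == 0 then 1 else -1))).
    split; last by rewrite det3 !mxE ?eqxx ?ord3_neq /=; ring.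
    apply/matrixP => i j; elim/ord3_ind: i; elim/ord3_ind: j;
      by rewrite !(mxE, big_ord3) ?eqxx ?ord3_neq /=; ring.
  apply/matrixP => i j; rewrite ord1 {j}; elim/ord3_ind: i;
    by rewrite !(mxE, big_ord3) ?eqxx ?ord3_neq /= ?x0 ?y0 ?z1; ring.
pose k := (1 - u 2 0)^-1; pose n := u - delta_mx 2 0.
have k1 : k * (1 - u 2 0) = 1 by rewrite mulVf // subr_eq0 eq_sym.
have nn : n^T *m n = (2 * (1 - u 2 0))%:M.
  apply/matrixP => i j; rewrite !ord1 !(mxE, big_ord3) ?eqxx ?ord3_neq /=.
  by move: n1; lra.
have nu : n^T *m u = (1 - u 2 0)%:M.
  apply/matrixP => i j; rewrite !ord1 !(mxE, big_ord3) ?eqxx ?ord3_neq /=.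
  by move: n1; lra.
(* The half-turn about the line of [n] is [2 n n^T / |n|^2 - 1]; as [|n|^2 = 2 (1 - u_3)], its
   coefficient is [k]. *)
exists (k *: (n *m n^T) - 1%:M); last first.
  rewrite mulmxBl mul1mx -scalemxAl -mulmxA nu mul_mx_scalar scalerA k1 scale1r.
  by rewrite /n addrAC subrr add0r.
split.
  have PP : (n *m n^T) *m (n *m n^T) = (2 * (1 - u 2 0)) *: (n *m n^T).
    by rewrite -mulmxA (mulmxA n^T) nn mul_scalar_mx scalemxAr.
  have PT : (n *m n^T)^T = n *m n^T by rewrite trmx_mul trmxK.
  move: (n *m n^T) PP PT => P PP PT; rewrite raddfB /= linearZ /= PT trmx1.
  rewrite mulmxBl mul1mx mulmxBr mulmx1 -scalemxAl -scalemxAr PP !scalerA.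
  rewrite mulrCA -mulrA k1 mulr1 mulr_natl mulr2n scalerDl addrK opprB.
  by rewrite addrCA subrr addr0.
(* The eigenvalues are [k |n|^2 - 1] on [n], and [-1] twice. *)
have -> : \det (k *: (n *m n^T) - 1%:M) = k * (n^T *m n) 0 0 - 1.
  rewrite det3 !(mxE, big_ord3, big_ord1) ?eqxx ?ord3_neq /=; ring.
by rewrite nn mxE eqxx mulr1n mulrCA k1; ring.
Qed.

(** * The integrability condition in blocks *)

(** As [A X x A Y = cof A (X x Y)] and [A X x Y + X x A Y = (tr A - A^T) (X x Y)], the hypothesis
    amounts to [cof A = 1 + A (tr A - A^T)]. *)
Lemma nijenhuis_axis (R : realType) (A : 'M[R]_3) :
  (forall X Y, su2_bracket (A *m X) (A *m Y) - su2_bracket X Y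
     - A *m (su2_bracket (A *m X) Y + su2_bracket X (A *m Y)) = 0) ->
  exists t u, u^T *m u = 1%:M /\ A = axis_mx t u.
Proof.
move=> N.
pose a := A 0 0; pose b := A 1 1; pose c := A 2 2.
pose d := (A 0 1 + A 1 0) / 2; pose e := (A 0 2 + A 2 0) / 2.
pose f := (A 1 2 + A 2 1) / 2; pose x := (A 2 1 - A 1 2) / 2.
pose y := (A 0 2 - A 2 0) / 2; pose z := (A 1 0 - A 0 1) / 2.
have A00 : A 0 0 = a by []. have A11 : A 1 1 = b by []. have A22 : A 2 2 = c by [].
have A01 : A 0 1 = d - z by rewrite /d /z; lra.
have A10 : A 1 0 = d + z by rewrite /d /z; lra.
have A02 : A 0 2 = e + y by rewrite /e /y; lra.
have A20 : A 2 0 = e - y by rewrite /e /y; lra.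
have A12 : A 1 2 = f - x by rewrite /f /x; lra.
have A21 : A 2 1 = f + x by rewrite /f /x; lra.
have AE := (A00, A11, A22, A01, A10, A02, A20, A12, A21).
move: (a) (b) (c) (d) (e) (f) (x) (y) (z) AE => {A00 A11 A22 A01 A10 A02 A20 A12 A21}.
move=> {}a {}b {}c {}d {}e {}f {}x {}y {}z AE.
(* For cyclically consecutive [i], [j] the bracket of the basis vectors is some [e_l], so [N' i j k]
   gives the [(k, l)] entry of the relation. *)
have N' i j k := congr1 (fun M : 'cV_3 => M k 0) (N (delta_mx i 0) (delta_mx j 0)).
pose sm := (mulr0, mul0r, mulr1, mul1r, addr0, add0r, subr0, sub0r).
have [] := @cofactor_relation_axis R a b c d e f x y z.
- by have := N' 1 2 0; rewrite !(mxE, big_ord3) !ord3D ?eqxx !ord3_neq !AE /= !sm; lra.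
- by have := N' 2 0 1; rewrite !(mxE, big_ord3) !ord3D ?eqxx !ord3_neq !AE /= !sm; lra.
- by have := N' 0 1 2; rewrite !(mxE, big_ord3) !ord3D ?eqxx !ord3_neq !AE /= !sm; lra.
- by have := N' 2 0 0; rewrite !(mxE, big_ord3) !ord3D ?eqxx !ord3_neq !AE /= !sm; lra.
- by have := N' 1 2 1; rewrite !(mxE, big_ord3) !ord3D ?eqxx !ord3_neq !AE /= !sm; lra.
- by have := N' 0 1 0; rewrite !(mxE, big_ord3) !ord3D ?eqxx !ord3_neq !AE /= !sm; lra.
- by have := N' 1 2 2; rewrite !(mxE, big_ord3) !ord3D ?eqxx !ord3_neq !AE /= !sm; lra.
- by have := N' 0 1 1; rewrite !(mxE, big_ord3) !ord3D ?eqxx !ord3_neq !AE /= !sm; lra.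
- by have := N' 2 0 2; rewrite !(mxE, big_ord3) !ord3D ?eqxx !ord3_neq !AE /= !sm; lra.
move=> w1 [[aE bE cE] [dE eE fE]].
exists (a + b + c), (\col_i nth 0 [:: x; y; z] i); split.
  by apply/matrixP => i j; rewrite !ord1 !(mxE, big_ord3) /= -!expr2 w1.
apply/matrixP => i j; elim/ord3_ind: i; elim/ord3_ind: j;
  by rewrite !(mxE, big_ord1) !ord3D ?eqxx !ord3_neq !AE /=; lra.
Qed.

Lemma one_sqr_neq0 (R : realType) (x : R) : 1 + x ^+ 2 != 0.
Proof. by rewrite gt_eqF // ltr_wpDr // sqr_ge0. Qed.

Lemma invmx_right (R : comUnitRingType) (n : nat) (A B : 'M[R]_n) :
  A *m B = 1%:M -> invmx A = B.
Proof.
move=> AB; have [uA _] := mulmx1_unit AB.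
by rewrite -[invmx A]mulmx1 -AB mulKmx.
Qed.

Lemma complex_structure_conj (R : realType) (n : nat)
    (br : 'cV[R]_n -> 'cV[R]_n -> 'cV[R]_n) (Psi Psi' J : 'M[R]_n) :
  Psi *m Psi' = 1%:M ->
  (forall X Y, br (Psi *m X) (Psi *m Y) = Psi *m br X Y) ->
  is_complex_structure br J -> is_complex_structure br (Psi *m J *m Psi').
Proof.
move=> PP brP [JJ N]; have PP' := mulmx1C PP; split.
  rewrite -!mulmxA (mulmxA Psi' Psi) PP' mul1mx (mulmxA J) JJ.
  by rewrite mulNmx mul1mx mulmxN PP.
have JE Z : Psi *m J *m Psi' *m (Psi *m Z) = Psi *m (J *m Z).
  by rewrite -!mulmxA (mulmxA Psi' Psi) PP' mul1mx.
move=> X Y; rewrite -[X]mul1mx -[Y]mul1mx -PP -!(mulmxA Psi Psi').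
by rewrite !JE !brP !JE -!mulmxBr N mulmx0.
Qed.

Lemma SO3xSO3P (R : realType) (Psi : 'M[R]_(3 + 3)) :
  SO3xSO3 Psi -> Psi *m Psi^T = 1%:M /\
  forall X Y, su2su2_bracket (Psi *m X) (Psi *m Y) = Psi *m su2su2_bracket X Y.
Proof.
move=> [[P1 P2] [/= S1 S2] <-]; split.
  rewrite tr_block_mx !trmx0 mulmx_block !(mulmx0, mul0mx) !addr0 !add0r.
  by rewrite (proj1 S1) (proj1 S2) -scalar_mx_block.
move=> X Y; rewrite /su2su2_bracket.
have e (Z : 'cV[R]_(3 + 3)) : block_mx P1 0 0 P2 *m Z = col_mx (P1 *m usubmx Z) (P2 *m dsubmx Z).
  by rewrite -{1}[Z]vsubmxK mul_block_col !mul0mx addr0 add0r.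
by rewrite !e !col_mxKu !col_mxKd !SO3_su2_bracket.
Qed.

(** Evaluate the tensor on two vectors of the same factor. On the first, [J X = (A X, C X)], so the
    first component yields [N0 A] and the second [N1 A C]; the second factor is symmetric. *)
Lemma complex_structure_blocks (R : realType) (A B C D : 'M[R]_3) :
  let br := @su2_bracket R in
  let N0 A := forall X Y, br (A *m X) (A *m Y) - br X Y
                - A *m (br (A *m X) Y + br X (A *m Y)) = 0 in
  let N1 A C := forall X Y, br (C *m X) (C *m Y)
                = C *m (br (A *m X) Y + br X (A *m Y)) in
  is_complex_structure (@su2su2_bracket R) (block_mx A B C D) ->
  [/\ N0 A, N0 D, N1 A C & N1 D B].
Proof.
move=> br N0 N1 [_ N].
have br0l X : su2_bracket 0 X = 0 :> 'cV[R]_3.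
  by apply/matrixP => i j; rewrite !mxE; ring.
have br0r X : su2_bracket X 0 = 0 :> 'cV[R]_3.
  by apply/matrixP => i j; rewrite !mxE; ring.
have Nu X Y := N (col_mx X 0) (col_mx Y 0).
have Nd X Y := N (col_mx 0 X) (col_mx 0 Y).
have E := (mul_block_col, mulmx0, addr0, add0r, col_mxKu, col_mxKd, br0l, br0r,
  opp_col_mx, add_col_mx, oppr0, subr0, sub0r).
split=> X Y.
- have := Nu X Y; rewrite /su2su2_bracket !E -/br => /eqP.
  by rewrite col_mx_eq0 => /andP[/eqP E0 _]; rewrite -[RHS]E0 mulmxDr opprD addrA.
- have := Nd X Y; rewrite /su2su2_bracket !E -/br => /eqP.
  by rewrite col_mx_eq0 => /andP[_ /eqP E0]; rewrite -[RHS]E0 mulmxDr opprD addrA.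
- have := Nu X Y; rewrite /su2su2_bracket !E -/br => /eqP.
  by rewrite col_mx_eq0 => /andP[_]; rewrite mulmxDr -addrA -opprD subr_eq0 => /eqP.
- have := Nd X Y; rewrite /su2su2_bracket !E -/br => /eqP.
  by rewrite col_mx_eq0 => /andP[+ _]; rewrite mulmxDr -addrA -opprD subr_eq0 => /eqP.
Qed.

(** * Blocks with both axes at the pole *)

Local Notation e3 := (delta_mx 2 0 : 'cV_3).

(** The pole is [- e_3] rather than [e_3] so that the quarter turn has the sign it has in the
    canonical form. *)
Lemma axis_mx_pole (R : realType) (t : R) :
  axis_mx t (- e3) =
  \matrix_(i, j) nth 0 (nth [::] [:: [:: 0; 1; 0]; [:: -1; 0; 0]; [:: 0; 0; t]] i) j.
Proof.
by apply/matrixP => i j; elim/ord3_ind: i; elim/ord3_ind: j;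
  rewrite !(mxE, big_ord1) ?ord3D ?eqxx ?ord3_neq /=; ring.
Qed.

(* On the plane orthogonal to the axes [C] anticommutes with the quarter turn,
   so its block there has determinant [- (c00^2 + c01^2)]; the bracket relation
   makes this determinant vanish. *)
Lemma offdiagonal_block (R : realType) (s t : R) (C : 'M[R]_3) :
  C *m axis_mx t (- e3) + axis_mx s (- e3) *m C = 0 ->
  (forall X Y, su2_bracket (C *m X) (C *m Y) =
     C *m (su2_bracket (axis_mx t (- e3) *m X) Y
           + su2_bracket X (axis_mx t (- e3) *m Y))) ->
  C = C 2 2 *: (e3 *m e3^T).
Proof.
rewrite !axis_mx_pole => /matrixP anti.
(* The quarter turn maps [e_1] to [- e_2] and [e_2] to [e_1], so the right-hand side vanishes at
   this pair; the third coordinate on the left is the determinant of the plane block. *)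
move=> /(_ (delta_mx 0 0) (delta_mx 1 0)); rewrite -!colE => /matrixP /(_ 2 0).
rewrite !(mxE, big_ord3) !ord3D ?eqxx ?ord3_neq /= => det0.
have := (anti 0 0, anti 0 1, anti 0 2, anti 1 2, anti 2 0, anti 2 1).
rewrite !mxE !big_ord3 !mxE /= => -[[[[[a00 a01] a02] a12] a20] a21].
have c11 : C 1 1 = - C 0 0 by lra.
have c10 : C 1 0 = C 0 1 by lra.
have : C 0 0 ^+ 2 + C 0 1 ^+ 2 = 0 by rewrite c11 c10 in det0; lra.
move/eqP; rewrite paddr_eq0 ?sqr_ge0 // !sqrf_eq0 => /andP[/eqP c00 /eqP c01].
(* A quarter turn has no real eigenvalue, yet it multiplies the plane part of the last column by
   [- t], and that of the last row by [- s]; both are zero. *)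
have c12 : C 1 2 = - (t * C 0 2) by lra.
have c02 : C 0 2 = 0.
  by apply: (mulfI (one_sqr_neq0 t)); rewrite mulr0; rewrite c12 in a12; lra.
have c21 : C 2 1 = s * C 2 0 by lra.
have c20 : C 2 0 = 0.
  by apply: (mulfI (one_sqr_neq0 s)); rewrite mulr0; rewrite c21 in a21; lra.
rewrite c02 mulr0 oppr0 in c12; rewrite c20 mulr0 in c21.
rewrite c00 oppr0 in c11; rewrite c01 in c10.
apply/matrixP => i j; elim/ord3_ind: i; elim/ord3_ind: j;
  by rewrite trmx_delta mul_delta_mx !mxE ?eqxx ?ord3_neq /= ?mulr1 ?mulr0.
Qed.

Lemma Jcan_block (R : realType) (xi eta : R) :
  Jcan xi eta =
  block_mx (axis_mx xi (- e3)) (eta *: (e3 *m e3^T))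
           (- ((1 + xi ^+ 2) / eta) *: (e3 *m e3^T)) (axis_mx (- xi) (- e3)).
Proof.
apply/matrixP => i j; rewrite -(splitK i) -(splitK j).
case: (split i) => {}i; case: (split j) => {}j /=;
  rewrite ?(block_mxEul, block_mxEur, block_mxEdl, block_mxEdr) !mxE /=;
  elim/ord3_ind: i; elim/ord3_ind: j;
  rewrite !(mxE, big_ord1) ?ord3D ?eqxx ?ord3_neq /=; ring.
Qed.

(** * Equivalence of canonical forms *)

Lemma SO3_equivalent (R : realType) (J J' : 'M[R]_(3 + 3)) :
  equivalent_under (@SO3xSO3 R) J J' <->
  exists2 Psi, SO3xSO3 Psi & J' = Psi *m J *m Psi^T.
Proof.
split=> -[Psi SP ->]; exists Psi => //; have [PP _] := SO3xSO3P SP;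
  by rewrite (invmx_right PP).
Qed.

Lemma switchK (R : realType) : switch R *m switch R = 1%:M.
Proof.
by rewrite mulmx_block !(mulmx0, mul0mx, mulmx1) !addr0 !add0r -scalar_mx_block.
Qed.

(** The switch is an involution, so it can be moved from the conjugating matrix to the target. *)
Lemma switch_equivalent (R : realType) (J J' : 'M[R]_(3 + 3)) :
  equivalent_under (@switch_SO3xSO3 R) J J' <->
  equivalent_under (@SO3xSO3 R) J (switch R *m J' *m switch R).
Proof.
have inv Psi : SO3xSO3 Psi -> invmx (switch R *m Psi) = Psi^T *m switch R.
  move=> /SO3xSO3P[PP _]; apply: invmx_right.
  by rewrite -mulmxA (mulmxA Psi) PP mul1mx switchK.
split=> [[_ [Psi SP <-] ->]|/SO3_equivalent[Psi SP E]].
  apply/SO3_equivalent; exists Psi => //; rewrite inv // !mulmxA switchK mul1mx.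
  by rewrite -!mulmxA switchK mulmx1.
exists (switch R *m Psi); first by exists Psi.
rewrite inv // -(mulmxA _ Psi J) (mulmxA (switch R *m _)) -(mulmxA _ _ Psi^T) -E.
by rewrite !mulmxA switchK mul1mx -mulmxA switchK mulmx1.
Qed.

(** The switch exchanges the blocks in both diagonals; the new lower left coefficient is right
    because [eta] equals [(1 + xi^2) / ((1 + xi^2) / eta)]. *)
Lemma switch_Jcan (R : realType) (xi eta : R) : eta != 0 ->
  switch R *m Jcan xi eta *m switch R = Jcan (- xi) (- ((1 + xi ^+ 2) / eta)).
Proof.
move=> eta0; rewrite !Jcan_block !mulmx_block.
rewrite !(mulmx0, mul0mx, mulmx1, mul1mx) !addr0 !add0r sqrrN opprK.
congr (block_mx _ _ (_ *: _) _).
by rewrite invrN invf_div mulrN opprK mulrCA mulfV ?one_sqr_neq0 ?mulr1.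
Qed.

Lemma SO3_equivalent_Jcan (R : realType) (xi xi' eta eta' : R) :
  equivalent_under (@SO3xSO3 R) (Jcan xi eta) (Jcan xi' eta') <->
  xi' = xi /\ eta' = eta.
Proof.
have e31 : (- e3)^T *m (- e3) = 1%:M :> 'M[R]_1.
  apply/matrixP => i j; rewrite !ord1 !(mxE, big_ord3) ?eqxx ?ord3_neq /=; ring.
split=> [/SO3_equivalent[_ [[P1 P2] [/= S1 S2] <-]]|[-> ->]]; last first.
  apply/SO3_equivalent; exists 1%:M; last by rewrite trmx1 mulmx1 mul1mx.
  exists (1%:M, 1%:M); last by rewrite /= -scalar_mx_block.
  by split; split; rewrite ?trmx1 ?mulmx1 ?det1.
rewrite !Jcan_block tr_block_mx !trmx0 !mulmx_block.
rewrite !(mulmx0, mul0mx) !addr0 !add0r !SO3_axis_mx // => /eq_block_mx[E1 E2 _ E4].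
(* Both rotations fix [e_3], hence conjugation leaves [e_3 e_3^T] unchanged and the upper right
   blocks can be compared directly. *)
have P1e := axis_mx_inj E1; have P2e := axis_mx_inj E4.
split.
  by have := congr1 mxtrace E1; rewrite -P1e !mxtrace_axis_mx.
move: P1e P2e; rewrite !mulmxN => /oppr_inj P1e /oppr_inj P2e.
move: E2; rewrite -scalemxAr -scalemxAl mulmxA -P1e -mulmxA -trmx_mul -P2e.
by move=> /matrixP /(_ 2 2); rewrite trmx_delta mul_delta_mx !mxE !eqxx !mulr1.
Qed.

(** * Reduction to the canonical form, and the classification *)

Lemma complex_structure_Jcan (R : realType) (J : 'M[R]_(3 + 3)) :
  is_complex_structure (@su2su2_bracket R) J ->
  exists xi eta : R,
    eta != 0 /\ equivalent_under (@SO3xSO3 R) J (Jcan xi eta).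
Proof.
move=> cJ.
have [NA ND _ _] := @complex_structure_blocks R (ulsubmx J) (ursubmx J)
  (dlsubmx J) (drsubmx J) (eq_ind_r (is_complex_structure _) cJ (submxK J)).
have [t [u [/SO3_to_pole[P1 S1 P1u] AE]]] := nijenhuis_axis NA.
have [s [v [/SO3_to_pole[P2 S2 P2v] DE]]] := nijenhuis_axis ND.
pose Psi := block_mx P1 0 0 P2.
have SP : SO3xSO3 Psi by exists (P1, P2).
have [PP brP] := SO3xSO3P SP.
have := complex_structure_conj PP brP cJ.
pose B := P1 *m ursubmx J *m P2^T; pose C := P2 *m dlsubmx J *m P1^T.
have JE : Psi *m J *m Psi^T = block_mx (axis_mx t (- e3)) B C (axis_mx s (- e3)).
  rewrite -{1}(submxK J) tr_block_mx !trmx0 !mulmx_block AE DE.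
  by rewrite !(mulmx0, mul0mx) !addr0 !add0r !SO3_axis_mx // P1u P2v.
clearbody B C; rewrite JE => cJ'; have [_ _ N1 N2] := complex_structure_blocks cJ'.
have := proj1 cJ'; rewrite mulmx_block scalar_mx_block opp_block_mx !oppr0.
move=> /eq_block_mx[JJ1 JJ2 JJ3 JJ4].
(* For [B] the two factors trade places, so the sum in the relation is commuted. *)
have := offdiagonal_block (etrans (addrC _ _) JJ2) N2.
have := offdiagonal_block JJ3 N1.
move: (B 2 2) (C 2 2) => b c CE BE.
(* The [(3, 3)] entries of [J^2 = -1] read [t^2 + b c = -1] and [(t + s) c = 0]; hence [b] and [c]
   are nonzero, [s = - t] and [c = - (1 + t^2) / b]. *)
move: JJ1 JJ3; rewrite CE BE trmx_delta mul_delta_mx !axis_mx_pole.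
move=> /matrixP/(_ 2 2) JJ1 /matrixP/(_ 2 2) JJ3.
have bc : t ^+ 2 + b * c = -1 by move: JJ1; rewrite !mxE !big_ord3 !mxE /=; lra.
have ct : (t + s) * c = 0 by move: JJ3; rewrite !mxE !big_ord3 !mxE /=; lra.
have t1 := one_sqr_neq0 t.
have bc0 : b * c != 0 by apply: contra t1 => /eqP bc0; apply/eqP; lra.
have [b0 c0] : b != 0 /\ c != 0 by apply/andP; rewrite -negb_or -mulf_eq0.
exists t, b; split=> //; apply/SO3_equivalent; exists Psi => //.
rewrite JE Jcan_block BE CE; congr (block_mx _ _ (_ *: _) (axis_mx _ _)).
  by apply: (mulfI b0); rewrite mulrN mulrCA mulfV // mulr1; lra.
by move/eqP: ct; rewrite mulf_eq0 (negPf c0) orbF => /eqP; lra.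
Qed.

Theorem corollary3 (R : realType) :
  [/\ forall J : 'M[R]_(3 + 3),
        is_complex_structure (@su2su2_bracket R) J ->
        exists xi eta : R,
          eta != 0 /\ equivalent_under (@SO3xSO3 R) J (Jcan xi eta),
      forall xi xi' eta eta' : R, eta != 0 -> eta' != 0 ->
        equivalent_under (@SO3xSO3 R) (Jcan xi eta) (Jcan xi' eta') <->
        xi' = xi /\ eta' = eta &
      forall xi xi' eta eta' : R, eta != 0 -> eta' != 0 ->
        equivalent_under (@switch_SO3xSO3 R) (Jcan xi eta) (Jcan xi' eta') <->
        xi' = - xi /\ eta' = - ((1 + xi ^+ 2) / eta)].
Proof.
split; [exact: complex_structure_Jcan|by move=> *; exact: SO3_equivalent_Jcan|].
move=> xi xi' eta eta' eta0 eta'0.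
(* The map [y |-> - (1 + x^2) / y] is an involution; this converts the condition on the switched
   target [J(xi', eta')] into one that expresses [eta'] through [xi] and [eta]. *)
have dual (x y z : R) : y != 0 -> z = - ((1 + x ^+ 2) / y) -> y = - ((1 + x ^+ 2) / z).
  by move=> y0 ->; rewrite invrN invf_div mulrN opprK mulrCA mulfV ?one_sqr_neq0 ?mulr1.
split=> [/switch_equivalent|[-> etaE]].
  rewrite switch_Jcan // => /SO3_equivalent_Jcan[xiE etaE].
  have {}xiE : xi' = - xi by rewrite -xiE opprK.
  by split=> //; rewrite -(sqrrN xi) -xiE; apply: dual.
apply/switch_equivalent; rewrite switch_Jcan // SO3_equivalent_Jcan opprK sqrrN.
by split=> //; symmetry; apply: dual.
Qed.
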